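(* For the system formed by a heavy convex rigid body with smooth surface that rolls without slipping on a horizontal plane rotating with constant angular velocity $\kappa e_3$, let $Y_\kappa$ be the vector field with left-trivialized components $Y_\kappa(q,g)=\big(\kappa e_3^s\times x,\ \kappa\gamma\big)\in\mathbb{R}^3\times\mathbb{R}^3$ (the infinitesimal generator, corresponding to $\kappa\in\mathbb{R}\cong\mathrm{Lie}(S^1)$, of the $S^1$-action $\theta.(x,g)=(R_\theta x,R_\theta g)$). Then $$E_{L,Y_\kappa}|_M=\frac12K\cdot\Omega+m\mathcal{G}\,\rho\cdot\gamma-\kappa K\cdot\gamma+\frac12m\kappa^2\big(\|\rho\|^2-\|x\|^2\big),$$ where $K(g,\Omega)=\mathbb{I}\Omega+m\rho\times(\Omega\times\rho)$.
   Context: Setting. $\Sigma_s=\{O;e_1,e_2,e_3\}$ is an inertial frame; the plane is the one spanned by $e_1,e_2$ through $O$, rotating about $e_3$ with constant angular velocity $\kappa e_3$, $\kappa\in\mathbb{R}$; $e_3^s=(0,0,1)^T$. $x=(x_1,x_2,x_3)$ are the coordinates in $\Sigma_s$ of the center of mass $C$ of the body. $g\in\mathrm{SO}(3)$ is the attitude matrix: representatives of a vector in $\Sigma_s$ and in a body frame with origin $C$ are related by $u^s=gu^b$. The configuration manifold is $Q=\mathbb{R}^2\times\mathrm{SO}(3)\ni(q,g)$, $q=(x_1,x_2)$. $\Omega\in\mathbb{R}^3$ is the body representative of the angular velocity ($\dot g=g\hat\Omega$, $\hat\Omega a=\Omega\times a$), and $TQ$ is left-trivialized with coordinates $(q,g,\dot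 q,\Omega)$. $\gamma=\gamma(g)=g^{-1}e_3^s\in S^2$ is the Poisson vector; $\rho=\rho(g)$ is the body representative of the vector $PC$, with $P$ the point of the body in contact with the plane. The surface $\mathcal{S}$ of the body (in the body frame) is smooth and convex with Gauss map (outward unit normal) $G:\mathcal{S}\to S^2$ a diffeomorphism, and $\rho=F(\gamma)$ with $F(\gamma)=-G^{-1}(-\gamma)$. The holonomic constraint of contact is $x_3=\gamma\cdot\rho$, and then $\dot x_3=\gamma\cdot(\Omega\times\rho)$. $Q$ is identified with its image in $\mathbb{R}^3\times\mathrm{SO}(3)\ni(x,g)$ via $x=(q_1,q_2,\gamma\cdot\rho)$, and $TQ$ correspondingly, with $\dot x=(\dot q_1,\dot q_2,\gamma\cdot(\Omega\times\rho))$; tangent vectors and vector fields are written as pairs $(\dot x,\Omega)$. $m>0$ is the mass, $\mathcal{G}$ the gravitational acceleration, $\mathbb{I}$ the inertia tensor relative to the center of mass. The Lagrangian is $L=\frac12\mathbb{I}\Omega\cdot\Omega+\frac m2\big(\dot q_1^2+\dot q_2^2+(\gamma\cdot[\Omega\times\rho])^2\big)-m\mathcal{G}\gamma\cdot\rho$. The no-slipping constraint is $\dot x=g(\Omega\times\rho)+\kappa e_3^s\times(x-g\rho)$; it defines the constraint manifold $M\subset TQ$, identified with $\mathbb{R}^2\times\mathrm{SO}(3)\times\mathbb{R}^3\ni(q,g,\Omega)$. $R_\theta\in\mathrm{SO}(3)$ is rotation by $\theta$ about $e_3^s$. $p$ is the momentum 1-form generated by $L$ (in coordinates, the derivative of $L$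 with respect to the velocities), $E_L=\langle p,\cdot\rangle-L$, and for a vector field $Y$ on $Q$, $E_{L,Y}=E_L-\langle p,Y\rangle$, as functions on $TQ$. *)

(* Defs.v *)
From HB Require Import structures.
From mathcomp Require Import all_boot all_order all_algebra.
From mathcomp Require Import all_classical all_reals all_analysis.

Set Implicit Arguments.
Unset Strict Implicit.
Unset Printing Implicit Defensive.

Import Order.TTheory GRing.Theory Num.Theory.
Import numFieldNormedType.Exports.

Local Open Scope classical_set_scope.
Local Open Scope ring_scope.

(* The library norm `|u| on matrices is the sup norm, hence [enorm]. *)
Definition dotv (R : realType) n (u v : 'cV[R]_n) : R := (u^T *m v) 0 0.

Definition enorm (R : realType) n (u : 'cV[R]_n) : R := Num.sqrt (dotv u u).

(* Indices are taken in 'I_3 with its cyclic (mod 3) addition, so that this is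
   (u2 v3 - u3 v2, u3 v1 - u1 v3, u1 v2 - u2 v1). *)
Definition crossv (R : realType) (u v : 'cV[R]_3) : 'cV[R]_3 :=
  \col_(i < 3) (u (i + 1) 0 * v (i + 2%:R) 0 - u (i + 2%:R) 0 * v (i + 1) 0).

(* The j-th column is u x e_j, so that hat u *m a = u x a. *)
Definition hat (R : realType) (u : 'cV[R]_3) : 'M[R]_3 :=
  \matrix_(i, j) crossv u (delta_mx j 0) i 0.

Definition e3 (R : realType) : 'cV[R]_3 := delta_mx ord_max 0.

Definition SO3 (R : realType) : set 'M[R]_3 :=
  [set g | g *m g^T = 1%:M /\ \det g = 1].

Definition Rot3 (R : realType) (theta : R) : 'M[R]_3 :=
  \matrix_(i, j) nth 0 (nth [::]
    [:: [:: cos theta; - sin theta; 0];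
        [:: sin theta;   cos theta; 0];
        [:: 0;           0;         1]] i) j.

Definition sphere2 (R : realType) : set 'cV[R]_3 := [set u | enorm u = 1].

Definition iter_derive (R : realType) (V W : normedModType R)
  (vs : seq V) (f : V -> W) : V -> W := foldr (fun v h => 'D_v h) f vs.

(* C^infinity: every iterated directional derivative is differentiable. *)
Definition smooth_on_open (R : realType) (V W : normedModType R)
    (U : set V) (f : V -> W) :=
  open U /\ forall vs x, U x -> differentiable (iter_derive vs f) x.

(* Smoothness on a subset: local existence of smooth extensions. *)
Definition smooth_on (R : realType) (V W : normedModType R)
    (A : set V) (f : V -> W) :=
  forall a, A a -> exists (U : set V) (h : V -> W),
    [/\ U a, smooth_on_open U h & forall x, A x -> U x -> h x = f x].

(* Regular surface in R^3: locally a regular level set of a smooth function. *)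
Definition smooth_surface (R : realType) (S : set 'cV[R]_3) :=
  forall s, S s -> exists (U : set 'cV[R]_3) (phi : 'cV[R]_3 -> R),
    [/\ U s, smooth_on_open U phi,
        forall x, U x -> (S x <-> phi x = 0) &
        exists v, 'd phi s v != 0].

Definition tangent_vector (R : realType) (S : set 'cV[R]_3) (s v : 'cV[R]_3) :=
  exists c : R -> 'cV[R]_3,
    [/\ c 0 = s, \forall t \near 0, S (c t) & is_derive (0 : R) 1 c v].

Definition surface (R : realType) (B : set 'cV[R]_3) : set 'cV[R]_3 :=
  B `\` B°.

Definition outward_unit_normal (R : realType) (B : set 'cV[R]_3)
    (s n : 'cV[R]_3) :=
  [/\ enorm n = 1,
      forall v, tangent_vector (surface B) s v -> dotv n v = 0 &
      \forall t \near 0^'+, ~ B (s + t *: n)].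

Definition diffeomorphism (R : realType) (S T : set 'cV[R]_3)
    (G : 'cV[R]_3 -> 'cV[R]_3) :=
  [/\ set_bij S T G, smooth_on S G & smooth_on T (pinv S G)].

(* The body frame has its origin at the center of mass. *)
Record rigid_body (R : realType) := RigidBody {
  solid : set 'cV[R]_3;
  gauss : 'cV[R]_3 -> 'cV[R]_3;
  mass : R;
  inertia : 'M[R]_3;
  solid_compact : compact solid;
  solid_convex : convex_set (solid : set (convex_lmodType 'cV[R]_3));
  solid_interior : solid° !=set0;
  surface_smooth : smooth_surface (surface solid);
  gauss_normal : forall s, surface solid s ->
    outward_unit_normal solid s (gauss s);
  gauss_diffeo : diffeomorphism (surface solid) (@sphere2 R) gauss;
  mass_gt0 : 0 < mass;
  inertia_sym : inertia^T = inertia;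
  inertia_posdef : forall u, u != 0 -> 0 < dotv (inertia *m u) u
}.

(* Configurations (q, g); Q is the subset where g \in SO(3).  Left-trivialized
   velocities are pairs (dq/dt, Omega). *)
Definition config (R : realType) : Type := ('cV[R]_2 * 'M[R]_3)%type.
Notation velocity R := ('cV[R]_2 * 'cV[R]_3)%type.

Definition Q (R : realType) : set (config R) := [set y | SO3 y.2].

Definition gamma (R : realType) (g : 'M[R]_3) : 'cV[R]_3 := invmx g *m e3 R.

Definition F (R : realType) (b : rigid_body R) (u : 'cV[R]_3) : 'cV[R]_3 :=
  - pinv (surface (solid b)) (gauss b) (- u).

Definition rho (R : realType) (b : rigid_body R) (g : 'M[R]_3) : 'cV[R]_3 :=
  F b (gamma g).

Definition position (R : realType) (b : rigid_body R) (y : config R) :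
    'cV[R]_3 :=
  col_mx y.1 (const_mx (dotv (gamma y.2) (rho b y.2)) : 'cV_1).

Definition com_velocity (R : realType) (b : rigid_body R) (y : config R)
    (v : velocity R) : 'cV[R]_3 :=
  col_mx v.1
    (const_mx (dotv (gamma y.2) (crossv v.2 (rho b y.2))) : 'cV_1).

(* Embeddings of Q and TQ: (x, g) and (dx/dt, Omega). *)
Definition embed (R : realType) (b : rigid_body R) (y : config R) :
    'cV[R]_3 * 'M[R]_3 := (position b y, y.2).

Definition embedT (R : realType) (b : rigid_body R) (y : config R)
    (v : velocity R) : 'cV[R]_3 * 'cV[R]_3 := (com_velocity b y v, v.2).

Definition lagrangian (R : realType) (b : rigid_body R) (grav : R)
    (y : config R) (v : velocity R) : R :=
  2^-1 * dotv (inertia b *m v.2) v.2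
  + mass b / 2 * (v.1 0 0 ^+ 2 + v.1 1 0 ^+ 2
                  + dotv (gamma y.2) (crossv v.2 (rho b y.2)) ^+ 2)
  - mass b * grav * dotv (gamma y.2) (rho b y.2).

(* <p, w> at the point (y, v) of TQ: derivative of L along the fibre. *)
Definition momentum (R : realType) (L : config R -> velocity R -> R)
    (y : config R) (v w : velocity R) : R := 'd (L y) v w.

Definition energy (R : realType) (L : config R -> velocity R -> R)
    (y : config R) (v : velocity R) : R := momentum L y v v - L y v.

Definition moving_energy (R : realType) (L : config R -> velocity R -> R)
    (Y : config R -> velocity R) (y : config R) (v : velocity R) : R :=
  energy L y v - momentum L y v (Y y).

Definition constraint_manifold (R : realType) (b : rigid_body R) (kappa : R) :
    set (config R * velocity R) :=
  [set z | let: (y, v) := z in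
    Q y /\
    com_velocity b y v = y.2 *m crossv v.2 (rho b y.2)
      + crossv (kappa *: e3 R) (position b y - y.2 *m rho b y.2)].

Definition circle_action (R : realType) (theta : R)
    (z : 'cV[R]_3 * 'M[R]_3) : 'cV[R]_3 * 'M[R]_3 :=
  (Rot3 theta *m z.1, Rot3 theta *m z.2).

(* Y is the infinitesimal generator of the circle action on (the embedded) Q
   corresponding to xi \in R = Lie(S^1); the left-trivialized (dx/dt, Omega)
   stands for the actual velocity (dx/dt, g hat(Omega)). *)
Definition infinitesimal_generator (R : realType) (b : rigid_body R) (xi : R)
    (Y : config R -> velocity R) :=
  forall y, Q y ->
    is_derive (0 : R) 1 (fun t => circle_action (t * xi) (embed b y))
      ((embedT b y (Y y)).1, y.2 *m hat (embedT b y (Y y)).2).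

(* In the coordinates (dq/dt, Omega) of TQ one keeps the first two components
   of kappa e3 x x; the third one is recovered by [embedT]. *)
Definition Ykappa (R : realType) (b : rigid_body R) (kappa : R)
    (y : config R) : velocity R :=
  (@usubmx R 2 1 1 (kappa *: crossv (e3 R) (position b y)),
   kappa *: gamma y.2).

Definition K (R : realType) (b : rigid_body R) (g : 'M[R]_3)
    (Omega : 'cV[R]_3) : 'cV[R]_3 :=
  inertia b *m Omega
  + mass b *: crossv (rho b g) (crossv Omega (rho b g)).

(* Main.v *)
Require Import Defs.
From HB Require Import structures.
From mathcomp Require Import all_boot all_order all_algebra.
From mathcomp Require Import all_classical all_reals all_analysis.
From mathcomp Require Import ring.

Set Implicit Arguments.
Unset Strict Implicit.
Unset Printing Implicit Defensive.

Import Order.TTheory GRing.Theory Num.Theory.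
Import numFieldNormedType.Exports.
Local Open Scope classical_set_scope.
Local Open Scope ring_scope.

(** Write Y for the generator, a = kappa e3 x x and xdot for its and the
    body's center-of-mass velocities.  The kinetic energy is the quadratic
    form (I Omega . Omega + m |xdot|^2) / 2 in the velocities, because the
    third component of xdot depends linearly on Omega; hence
    <p, w> = I Omega . Omega_w + m xdot . xdot_w ([momentumE]), and
    subtracting <p, Y> from the energy completes a square in the
    translational part:
      m |xdot|^2 / 2 - m xdot . a = m |xdot - a|^2 / 2 - m |a|^2 / 2.

    The rolling constraint says exactly that xdot - a is a rigid rotation:
    since g gamma = e3 and g preserves cross products,
    xdot - a = g ((Omega - kappa gamma) x rho) ([rolling_relative_velocity]),
    so that g disappears from |xdot - a|^2.  Expanding this square in kappa
    produces the three terms of the formula: those of degree 0 and 1 are the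
    translational parts of K . Omega / 2 and kappa K . gamma, through
    (rho x (Omega x rho)) . w = (Omega x rho) . (w x rho).  In the term of
    degree 2, Lagrange's identity gives |gamma x rho|^2 = |rho|^2 - x3^2 and
    |e3 x x|^2 = |x|^2 - x3^2, both with x3 = gamma . rho by the contact
    condition, and x3 cancels in their difference.

    That Y generates the action follows from Rodrigues' formula for R_theta,
    which gives the derivative hat e3 at theta = 0, and from
    hat (g gamma) g = g hat gamma, which turns this spatial rotation rate
    into the body angular velocity kappa gamma. *)

(** * Vector algebra in three-space *)

Lemma cV3P (R : realType) (u v : 'cV[R]_3) :
  u 0 0 = v 0 0 -> u 1 0 = v 1 0 -> u 2%:R 0 = v 2%:R 0 -> u = v.
Proof.
move=> h0 h1 h2; apply/colP => -[[|[|[|//]]] lti].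
- by rewrite (_ : Ordinal lti = 0) //; exact: val_inj.
- by rewrite (_ : Ordinal lti = 1) //; exact: val_inj.
- by rewrite (_ : Ordinal lti = 2%:R) //; exact: val_inj.
Qed.

Lemma sum3E (V : nmodType) (f : 'I_3 -> V) : \sum_i f i = f 0 + f 1 + f 2%:R.
Proof.
rewrite !big_ord_recl big_ord0 addr0 addrA.
by congr (f _ + f _ + f _); apply: val_inj.
Qed.

Lemma dotvE (R : realType) n (u v : 'cV[R]_n) :
  dotv u v = \sum_i u i 0 * v i 0.
Proof. by rewrite /dotv mxE; apply: eq_bigr => i _; rewrite mxE. Qed.

Lemma dotv3E (R : realType) (u v : 'cV[R]_3) :
  dotv u v = u 0 0 * v 0 0 + u 1 0 * v 1 0 + u 2%:R 0 * v 2%:R 0.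
Proof. by rewrite dotvE sum3E. Qed.

Lemma crossv_0E (R : realType) (u v : 'cV[R]_3) :
  crossv u v 0 0 = u 1 0 * v 2%:R 0 - u 2%:R 0 * v 1 0.
Proof. by rewrite mxE !add0r. Qed.

Lemma crossv_1E (R : realType) (u v : 'cV[R]_3) :
  crossv u v 1 0 = u 2%:R 0 * v 0 0 - u 0 0 * v 2%:R 0.
Proof.
rewrite mxE (_ : 1 + 1 = 2%:R :> 'I_3) //.
by rewrite (_ : 1 + 2%:R = 0 :> 'I_3) //; exact: val_inj.
Qed.

Lemma crossv_2E (R : realType) (u v : 'cV[R]_3) :
  crossv u v 2%:R 0 = u 0 0 * v 1 0 - u 1 0 * v 0 0.
Proof.
rewrite mxE (_ : 2%:R + 1 = 0 :> 'I_3); last exact: val_inj.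
by rewrite (_ : 2%:R + 2%:R = 1 :> 'I_3) //; exact: val_inj.
Qed.

Lemma e3E (R : realType) :
  ((e3 R 0 0 = 0) * (e3 R 1 0 = 0) * (e3 R 2%:R 0 = 1))%type.
Proof. by rewrite !mxE. Qed.

Definition cross_coordE := (crossv_0E, crossv_1E, crossv_2E).

Lemma dotvC (R : realType) n (u v : 'cV[R]_n) : dotv u v = dotv v u.
Proof. by rewrite !dotvE; apply: eq_bigr => i _; rewrite mulrC. Qed.

Lemma dotvDl (R : realType) n (u v w : 'cV[R]_n) :
  dotv (u + v) w = dotv u w + dotv v w.
Proof. by rewrite /dotv linearD mulmxDl mxE. Qed.

Lemma dotvZl (R : realType) n a (u w : 'cV[R]_n) :
  dotv (a *: u) w = a * dotv u w.
Proof. by rewrite /dotv linearZ /= -scalemxAl mxE. Qed.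

Lemma dotvDr (R : realType) n (u v w : 'cV[R]_n) :
  dotv w (u + v) = dotv w u + dotv w v.
Proof. by rewrite !(dotvC w) dotvDl. Qed.

Lemma dotvZr (R : realType) n a (u w : 'cV[R]_n) :
  dotv w (a *: u) = a * dotv w u.
Proof. by rewrite !(dotvC w) dotvZl. Qed.

Lemma crossvZl (R : realType) a (u v : 'cV[R]_3) :
  crossv (a *: u) v = a *: crossv u v.
Proof. by apply/colP => i; rewrite !mxE; ring. Qed.

Lemma crossvDl (R : realType) (u v w : 'cV[R]_3) :
  crossv (u + v) w = crossv u w + crossv v w.
Proof. by apply/colP => i; rewrite !mxE; ring. Qed.

Lemma crossvDr (R : realType) (u v w : 'cV[R]_3) :
  crossv w (u + v) = crossv w u + crossv w v.
Proof. by apply/colP => i; rewrite !mxE; ring. Qed.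

Lemma crossvNr (R : realType) (u v : 'cV[R]_3) :
  crossv u (- v) = - crossv u v.
Proof. by apply/colP => i; rewrite !mxE; ring. Qed.

Lemma dotv_crossvl (R : realType) (u v : 'cV[R]_3) : dotv u (crossv u v) = 0.
Proof. by rewrite dotv3E !cross_coordE; ring. Qed.

(** The form in which the inertia of a point mass at [u] enters a scalar
    product: it makes [K] symmetric in the two angular velocities. *)
Lemma dotv_double_crossv (R : realType) (u v w : 'cV[R]_3) :
  dotv (crossv u (crossv v u)) w = dotv (crossv v u) (crossv w u).
Proof. by rewrite !dotv3E !cross_coordE; ring. Qed.

Lemma lagrange_identity (R : realType) (u v : 'cV[R]_3) :
  dotv (crossv u v) (crossv u v) = dotv u u * dotv v v - dotv u v ^+ 2.
Proof. by rewrite !dotv3E !cross_coordE; ring. Qed.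

Lemma enorm2 (R : realType) n (u : 'cV[R]_n) : enorm u ^+ 2 = dotv u u.
Proof.
rewrite sqr_sqrtr // dotvE; apply: sumr_ge0 => i _.
by rewrite -expr2 sqr_ge0.
Qed.

Lemma mulmx3E (R : realType) n (A : 'M[R]_3) (B : 'M[R]_(3, n)) i j :
  (A *m B) i j = A i 0 * B 0 j + A i 1 * B 1 j + A i 2%:R * B 2%:R j.
Proof. by rewrite mxE sum3E. Qed.

Lemma det3E (R : realType) (A : 'M[R]_3) :
  \det A = A 0 0 * (A 1 1 * A 2%:R 2%:R - A 1 2%:R * A 2%:R 1)
         - A 0 1 * (A 1 0 * A 2%:R 2%:R - A 1 2%:R * A 2%:R 0)
         + A 0 2%:R * (A 1 0 * A 2%:R 1 - A 1 1 * A 2%:R 0).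
Proof.
rewrite (expand_det_row _ 0) sum3E /cofactor !(expand_det_row _ 0).
rewrite !big_ord_recl !big_ord0 /cofactor !det_mx11 !mxE.
have l00 : lift (0 : 'I_3) (0 : 'I_2) = 1 by exact: val_inj.
have l01 : lift (0 : 'I_3) (1 : 'I_2) = 2%:R by exact: val_inj.
have l10 : lift (1 : 'I_3) (0 : 'I_2) = 0 by exact: val_inj.
have l11 : lift (1 : 'I_3) (1 : 'I_2) = 2%:R by exact: val_inj.
have l20 : lift (2%:R : 'I_3) (0 : 'I_2) = 0 by exact: val_inj.
have l21 : lift (2%:R : 'I_3) (1 : 'I_2) = 1 by exact: val_inj.
have [k0 k1] : lift (0 : 'I_2) (0 : 'I_1) = 1 /\ lift (1 : 'I_2) (0 : 'I_1) = 0.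
  by split; apply: val_inj.
rewrite ?k0 ?k1 ?(l00, l01, l10, l11, l20, l21).
by rewrite /= !add0n /=; ring.
Qed.

Lemma hat_mulmx (R : realType) (u a : 'cV[R]_3) : hat u *m a = crossv u a.
Proof.
apply: cV3P; rewrite mulmx3E ![hat _ _ _]mxE !cross_coordE !mxE /=; ring.
Qed.

(** The cofactor identity: paired with an arbitrary [w], both sides are the
    determinant of the matrix with columns [g w], [g u], [g v]. *)
Lemma trmx_mul_crossv (R : realType) (g : 'M[R]_3) (u v : 'cV[R]_3) :
  g^T *m crossv (g *m u) (g *m v) = \det g *: crossv u v.
Proof.
apply: cV3P; rewrite [LHS]mulmx3E ![_^T _ _]mxE [RHS]mxE det3E.
all: rewrite !cross_coordE !mulmx3E; ring.
Qed.

Lemma SO3_mul_crossv (R : realType) (g : 'M[R]_3) (u v : 'cV[R]_3) :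
  SO3 g -> g *m crossv u v = crossv (g *m u) (g *m v).
Proof.
move=> [gg' dg]; have := congr1 (mulmx g) (trmx_mul_crossv g u v).
by rewrite mulmxA gg' mul1mx dg scale1r => ->.
Qed.

Lemma SO3_dotv (R : realType) (g : 'M[R]_3) (u v : 'cV[R]_3) :
  SO3 g -> dotv (g *m u) (g *m v) = dotv u v.
Proof.
move=> [gg' _]; rewrite /dotv trmx_mul mulmxA -[X in X *m v]mulmxA.
by rewrite (mulmx1C gg') mulmx1.
Qed.

Lemma SO3_unitmx (R : realType) (g : 'M[R]_3) : SO3 g -> g \in unitmx.
Proof. by move=> [_ dg]; rewrite unitmxE dg unitr1. Qed.

Lemma mul_gamma (R : realType) (g : 'M[R]_3) : SO3 g -> g *m gamma g = e3 R.
Proof. by move=> /SO3_unitmx gu; rewrite /gamma mulKVmx. Qed.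

Lemma dotv_gamma (R : realType) (g : 'M[R]_3) :
  SO3 g -> dotv (gamma g) (gamma g) = 1.
Proof.
move=> gSO; rewrite -(SO3_dotv _ _ gSO) mul_gamma // dotv3E !e3E; ring.
Qed.

Lemma hatZ (R : realType) a (u : 'cV[R]_3) : hat (a *: u) = a *: hat u.
Proof.
by apply/matrixP => i j; rewrite mxE crossvZl mxE [RHS]mxE [hat u i j]mxE.
Qed.

(** This converts a body angular velocity into the spatial one. *)
Lemma SO3_hat (R : realType) (g : 'M[R]_3) (u : 'cV[R]_3) :
  SO3 g -> g *m hat u = hat (g *m u) *m g.
Proof.
move=> gSO; apply/matrixP => i j.
have := SO3_mul_crossv u (delta_mx j 0) gSO; rewrite -!hat_mulmx !mulmxA.
by rewrite -!colE => /colP/(_ i); rewrite !mxE.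
Qed.

(** * Differentials of linear maps and of scalar products *)

Lemma is_diff_sum (R : realType) (V W : normedModType R) n
    (f df : 'I_n -> V -> W) (x : V) :
  (forall i, is_diff x (f i) (df i)) ->
  is_diff x (\sum_i f i) (\sum_i df i).
Proof.
move=> fx; apply: (big_ind2 (fun f df : V -> W => is_diff x f df)) => //.
- exact: is_diff_cst.
- by move=> f1 g1 f2 g2 ? ?; apply: is_diffD.
Qed.

Lemma is_diff_continuous_linear (R : realType) (V W : normedModType R)
    (f : {linear V -> W}) (x : V) : continuous f -> is_diff x f f.
Proof.
by move=> fc; apply: DiffDef; [exact: linear_differentiable|rewrite diff_lin].
Qed.

Lemma is_diff_coord (R : realType) m n (M : 'M[R]_(m, n)) i j :
  is_diff M (fun N : 'M[R]_(m, n) => N i j : R) (fun N => N i j).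
Proof.
pose f : 'M[R]_(m, n) -> R := fun N => N i j.
have lf : linear f by move=> a u v; rewrite /f !mxE.
pose Fl : {linear 'M[R]_(m, n) -> R} :=
  HB.pack f (GRing.isLinear.Build _ _ _ _ f lf).
exact: (@is_diff_continuous_linear _ _ _ Fl M (@coord_continuous _ _ _ i j)).
Qed.

Lemma is_diff_dotv (R : realType) (V : normedModType R) n
    (f g df dg : V -> 'cV[R]_n) (x : V) :
  is_diff x f df -> is_diff x g dg ->
  is_diff x (fun v => dotv (f v) (g v))
    (fun w => dotv (df w) (g x) + dotv (f x) (dg w)).
Proof.
move=> fx gx.
have cf i : is_diff x (fun v => f v i 0) (fun w => df w i 0).
  exact: (is_diff_comp fx (is_diff_coord (f x) i 0)).
have cg i : is_diff x (fun v => g v i 0) (fun w => dg w i 0).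
  exact: (is_diff_comp gx (is_diff_coord (g x) i 0)).
have := is_diff_sum (fun i => is_diffM (cf i) (cg i)).
rewrite (_ : \sum_i _ = (fun v => dotv (f v) (g v))); last first.
  by apply/funext => v; rewrite dotvE fct_sumE.
move=> h; apply: is_diff_eq h _; apply/funext => w; rewrite fct_sumE.
rewrite !dotvE -big_split; apply: eq_bigr => i _ /=.
rewrite addrC; congr (_ + _); exact: mulrC.
Qed.

(** In finite dimension continuity is automatic: expanded on the canonical
    basis, [f] is a finite sum of coordinates times constant vectors. *)
Lemma is_diff_linear (R : realType) (W : normedModType R) m n
    (f : {linear ('cV[R]_m * 'cV[R]_n)%type -> W}) (x : 'cV[R]_m * 'cV[R]_n) :
  is_diff x f f.
Proof.
have decomp (u : 'cV[R]_m) (v : 'cV[R]_n) :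
    (u, v) = \sum_i u i 0 *: (delta_mx i 0, 0)
           + \sum_j v j 0 *: (0, delta_mx j 0).
  have sum_delta k (w : 'cV[R]_k) : w = \sum_i w i 0 *: delta_mx i 0.
    by rewrite {1}[w]matrix_sum_delta; apply: eq_bigr => i _; rewrite big_ord1.
  apply: injective_projections; rewrite /= !raddf_sum /=.
    rewrite [X in _ + X]big1 ?addr0; first exact: sum_delta.
    by move=> i _; rewrite scaler0.
  rewrite big1 ?add0r; first exact: sum_delta.
  by move=> i _; rewrite scaler0.
pose V : Type := ('cV[R]_m * 'cV[R]_n)%type.
have fE : (f : V -> W) = \sum_i (fun v : V => v.1 i 0 *: f (delta_mx i 0, 0))
                       + \sum_j (fun v : V => v.2 j 0 *: f (0, delta_mx j 0)).
  apply/funext => -[u v]; rewrite {1}decomp linearD !linear_sum /=.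
  rewrite !fctE !fct_sumE.
  by congr (_ + _); apply: eq_bigr => i _; rewrite linearZ.
have cont1 : continuous (fst : 'cV[R]_m * 'cV[R]_n -> 'cV[R]_m).
  by move=> p; exact: cvg_fst.
have cont2 : continuous (snd : 'cV[R]_m * 'cV[R]_n -> 'cV[R]_n).
  by move=> p; exact: cvg_snd.
have c1 i : is_diff x (fun v : 'cV[R]_m * 'cV[R]_n => v.1 i 0)
    (fun v => v.1 i 0).
  exact: (is_diff_comp (is_diff_continuous_linear x cont1)
    (is_diff_coord x.1 i 0)).
have c2 i : is_diff x (fun v : 'cV[R]_m * 'cV[R]_n => v.2 i 0)
    (fun v => v.2 i 0).
  exact: (is_diff_comp (is_diff_continuous_linear x cont2)
    (is_diff_coord x.2 i 0)).
rewrite {1}fE; apply: is_diff_eq; last exact: (esym fE).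
apply: is_diffD; apply: is_diff_sum => i.
  exact: (is_diff_comp (c1 i) (is_diff_scalel _ _)).
exact: (is_diff_comp (c2 i) (is_diff_scalel _ _)).
Qed.

(** * The Lagrangian and its momentum *)

Lemma col_mx21E (R : realType) (a : 'cV[R]_2) (c : R) :
  let u : 'cV[R]_3 := col_mx a (const_mx c : 'cV_1) in
  ((u 0 0 = a 0 0) * (u 1 0 = a 1 0) * (u 2%:R 0 = c))%type.
Proof.
move=> u; have i0 : 0 = lshift 1 (0 : 'I_2) :> 'I_3 by exact: val_inj.
have i1 : 1 = lshift 1 (1 : 'I_2) :> 'I_3 by exact: val_inj.
have i2 : 2%:R = rshift 2 (0 : 'I_1) :> 'I_3 by exact: val_inj.
have up (i : 'I_2) : u (lshift 1 i) 0 = a i 0 by exact: col_mxEu.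
have down : u (rshift 2 (0 : 'I_1)) 0 = c by rewrite [LHS]col_mxEd mxE.
by rewrite i2 i1 i0 !up down.
Qed.

Lemma com_velocity_is_linear (R : realType) (b : rigid_body R) (y : config R) :
  linear (com_velocity b y).
Proof.
move=> a u v; apply: cV3P; rewrite [RHS]mxE [X in _ = X + _]mxE.
all: rewrite !col_mx21E /= ?mxE //.
by rewrite crossvDl crossvZl dotvDr dotvZr.
Qed.

HB.instance Definition _ (R : realType) (b : rigid_body R) (y : config R) :=
  GRing.isLinear.Build R (velocity R) 'cV[R]_3 _ (com_velocity b y)
    (com_velocity_is_linear b y).

Lemma lagrangianE (R : realType) (b : rigid_body R) grav y v :
  lagrangian b grav y v
  = 2^-1 * dotv (inertia b *m v.2) v.2
  + mass b / 2 * dotv (com_velocity b y v) (com_velocity b y v)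
  - mass b * grav * dotv (gamma y.2) (rho b y.2).
Proof.
by rewrite /lagrangian [dotv (com_velocity _ _ _) _]dotv3E !col_mx21E !expr2.
Qed.

Lemma dotv_inertiaC (R : realType) (b : rigid_body R) u v :
  dotv (inertia b *m u) v = dotv (inertia b *m v) u.
Proof. by rewrite [RHS]dotvC /dotv trmx_mul inertia_sym mulmxA. Qed.

(** The potential is constant along the fibre, so the fibre derivative is the
    polarization of the kinetic quadratic form. *)
Lemma momentumE (R : realType) (b : rigid_body R) grav y v w :
  momentum (lagrangian b grav) y v w
  = dotv (inertia b *m v.2) w.2
  + mass b * dotv (com_velocity b y v) (com_velocity b y w).
Proof.
rewrite /momentum.
have dI := is_diff_linear (mulmx (inertia b) \o snd) v.
have dO := is_diff_linear snd v.
have dC := is_diff_linear (com_velocity b y) v.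
have dT1 := is_diffZ 2^-1 (is_diff_dotv dI dO).
have dT2 := is_diffZ (mass b / 2) (is_diff_dotv dC dC).
have dU := is_diff_cst (mass b * grav * dotv (gamma y.2) (rho b y.2)) v.
have := is_diffB (is_diffD dT1 dT2) dU.
rewrite (_ : _ - _ = lagrangian b grav y); last first.
  by apply/funext => u; rewrite lagrangianE.
case=> _ ->; rewrite !fctE /=.
rewrite (dotv_inertiaC b w.2) (dotvC (com_velocity b y w)) subr0.
by rewrite /GRing.scale /=; field.
Qed.

(** * The circle action and its infinitesimal generator *)

(** The third component of the embedded velocity, gamma . (kappa gamma x rho),
    vanishes, as does that of e3 x x: the rotation preserves the height. *)
Lemma Ykappa_embedT (R : realType) (b : rigid_body R) kappa y :
  embedT b y (Ykappa b kappa y)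
  = (kappa *: crossv (e3 R) (position b y), kappa *: gamma y.2).
Proof.
congr (_, _); apply: cV3P; rewrite ?col_mx21E.
- rewrite mxE; congr (_ _ _); exact: val_inj.
- rewrite mxE; congr (_ _ _); exact: val_inj.
- by rewrite /= crossvZl dotvZr dotv_crossvl mxE crossv_2E !e3E; ring.
Qed.

Lemma Rot3_rodrigues (R : realType) (t : R) :
  Rot3 t = 1%:M + sin t *: hat (e3 R)
         + (1 - cos t) *: hat (e3 R) *m hat (e3 R).
Proof.
apply/matrixP => -[[|[|[|//]]] lti] [[|[|[|//]]] ltj].
all: rewrite !mxE sum3E !mxE /=; ring.
Qed.

Lemma is_derive_scalel (R : realType) (V : normedModType R) (f : R -> R)
    (x df : R) (w : V) :
  is_derive x 1 f df -> is_derive x 1 (fun t => f t *: w) (df *: w).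
Proof.
case=> /derivable1_diffP fx <-; apply: DeriveDef.
  by apply/derivable1_diffP; exact: differentiableZl.
by rewrite deriveE ?diffZl //; [rewrite deriveE|exact: differentiableZl].
Qed.

Lemma Ykappa_generator (R : realType) (b : rigid_body R) kappa :
  infinitesimal_generator b kappa (Ykappa b kappa).
Proof.
move=> y Qy; rewrite Ykappa_embedT //=.
pose H := hat (e3 R); pose x := position b y.
(* Only the sine term has a nonzero derivative at 0. *)
rewrite (_ : (fun t => _) = cst (embed b y)
  + (fun t => sin (t * kappa) *: (H *m x, H *m y.2))
  + (fun t => (1 - cos (t * kappa)) *: (H *m H *m x, H *m H *m y.2)));
  last first.
  apply/funext => t; rewrite !fctE /=.
  have act k (z : 'M[R]_(3, k)) : Rot3 (t * kappa) *m z = z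
      + sin (t * kappa) *: (H *m z) + (1 - cos (t * kappa)) *: (H *m H *m z).
    by rewrite Rot3_rodrigues !mulmxDl mul1mx -!scalemxAl.
  by apply: injective_projections; exact: act.
have dm : is_derive (0 : R) 1 (fun t : R => t * kappa) kappa.
  have := is_derive_scalel (kappa : R^o) (is_derive_id (0 : R) 1).
  by rewrite scale1r.
have ds : is_derive (0 : R) 1 (fun t : R => sin (t * kappa)) kappa.
  have := @is_derive1_comp _ sin ( *%R^~ kappa) 0 _ _ (is_derive_sin _) dm.
  by rewrite mul0r cos0 mul1r.
have dc : is_derive (0 : R) 1 (fun t : R => 1 - cos (t * kappa)) 0.
  have := is_deriveB (is_derive_cst (1 : R^o) (0 : R) 1)
    (@is_derive1_comp _ cos ( *%R^~ kappa) 0 _ _ (is_derive_cos _) dm).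
  by rewrite mul0r sin0 oppr0 mul0r subr0.
have := is_deriveD (is_deriveD (is_derive_cst (embed b y) (0 : R) 1)
  (is_derive_scalel (H *m x, H *m y.2) ds))
  (is_derive_scalel (H *m H *m x, H *m H *m y.2) dc).
move=> h; apply: is_derive_eq h _; rewrite scale0r addr0 add0r.
apply: injective_projections => /=; first by rewrite hat_mulmx.
by rewrite SO3_hat // -scalemxAr mul_gamma // hatZ scalemxAl.
Qed.

(** * The moving energy on the constraint manifold *)

(** Relative to the rotating plane the body moves with angular velocity
    Omega - kappa gamma, and rolling means that this rotation alone
    determines the velocity of the center of mass relative to the plane. *)
Lemma rolling_relative_velocity (R : realType) (b : rigid_body R) kappa y v :
  constraint_manifold b kappa (y, v) ->
  com_velocity b y v = y.2 *m crossv (v.2 - kappa *: gamma y.2) (rho b y.2)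
                     + kappa *: crossv (e3 R) (position b y).
Proof.
move=> [Qy ->]; rewrite crossvDl -scaleNr !crossvZl mulmxDr -scalemxAr.
rewrite (SO3_mul_crossv (gamma _)) // mul_gamma //.
rewrite crossvDr (crossvNr _ (_ *m _)).
by rewrite scaleNr scalerBr [X in _ + X]addrC addrA.
Qed.

Lemma dotv_e3_position (R : realType) (b : rigid_body R) y :
  dotv (e3 R) (position b y) = dotv (gamma y.2) (rho b y.2).
Proof. by rewrite dotv3E !e3E !col_mx21E; ring. Qed.

Lemma moving_energyE (R : realType) (b : rigid_body R) grav kappa y v :
  constraint_manifold b kappa (y, v) ->
  moving_energy (lagrangian b grav) (Ykappa b kappa) y v
  = 2^-1 * dotv (K b y.2 v.2) v.2
    + mass b * grav * dotv (rho b y.2) (gamma y.2)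
    - kappa * dotv (K b y.2 v.2) (gamma y.2)
    + 2^-1 * mass b * kappa ^+ 2
      * (enorm (rho b y.2) ^+ 2 - enorm (position b y) ^+ 2).
Proof.
move=> onM; have [Qy _] := onM; have cE := rolling_relative_velocity onM.
have [Yx Yg] : com_velocity b y (Ykappa b kappa y)
    = kappa *: crossv (e3 R) (position b y)
    /\ (Ykappa b kappa y).2 = kappa *: gamma y.2.
  by have := Ykappa_embedT b kappa y; case.
rewrite /moving_energy /energy !momentumE lagrangianE Yx Yg !enorm2 /K.
rewrite (dotvC (rho b y.2) (gamma y.2)).
move: cE; set a := kappa *: crossv _ _; set c := com_velocity b y v.
set u := crossv (_ - _) _ => cE.
(* Completing the square: |c - a|^2 = |g u|^2 = |u|^2. *)
have cc : dotv c c = dotv u u + 2 * dotv c a - dotv a a.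
  by rewrite cE !(dotvDl, dotvDr) SO3_dotv // (dotvC a); ring.
have aa : dotv a a = kappa ^+ 2 *
    (dotv (position b y) (position b y) - dotv (gamma y.2) (rho b y.2) ^+ 2).
  rewrite /a dotvZl dotvZr lagrange_identity dotv_e3_position.
  by rewrite -{1 2}(mul_gamma Qy) SO3_dotv // dotv_gamma //; ring.
have uu : dotv u u
    = dotv (crossv v.2 (rho b y.2)) (crossv v.2 (rho b y.2))
    - 2 * kappa
      * dotv (crossv v.2 (rho b y.2)) (crossv (gamma y.2) (rho b y.2))
    + kappa ^+ 2 * (dotv (rho b y.2) (rho b y.2)
                    - dotv (gamma y.2) (rho b y.2) ^+ 2).
  have -> : dotv (rho b y.2) (rho b y.2) - dotv (gamma y.2) (rho b y.2) ^+ 2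
      = dotv (crossv (gamma y.2) (rho b y.2)) (crossv (gamma y.2) (rho b y.2)).
    by rewrite lagrange_identity dotv_gamma // mul1r.
  rewrite /u crossvDl -scaleNr crossvZl !(dotvDl, dotvDr, dotvZl, dotvZr).
  by rewrite (dotvC (crossv (gamma _) _) (crossv v.2 _)); ring.
rewrite !dotvDl !dotvZl !dotv_double_crossv dotvZr cc uu aa.
by field.
Qed.

Theorem proposition15 (R : realType) (b : rigid_body R) (grav kappa : R) :
  [/\ forall y, Q y ->
        embedT b y (Ykappa b kappa y)
        = (kappa *: crossv (e3 R) (position b y), kappa *: gamma y.2),
      infinitesimal_generator b kappa (Ykappa b kappa) &
      forall (q : 'cV[R]_2) (g : 'M[R]_3) (v : velocity R),
        constraint_manifold b kappa ((q, g), v) ->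
        let x := position b (q, g) in
        let Omega := v.2 in
        moving_energy (lagrangian b grav) (Ykappa b kappa) (q, g) v
        = 2^-1 * dotv (K b g Omega) Omega
          + mass b * grav * dotv (rho b g) (gamma g)
          - kappa * dotv (K b g Omega) (gamma g)
          + 2^-1 * mass b * kappa ^+ 2 * (enorm (rho b g) ^+ 2 - enorm x ^+ 2)].
Proof.
split; [by move=> y _; exact: Ykappa_embedT|exact: Ykappa_generator|].
by move=> q g v rolling x Omega; rewrite (moving_energyE grav rolling).
Qed.
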